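(* Let $K$ be an infinite metric space and $f:K\to\mathbb{C}$ a bounded function. Let $\mu$ be the least cardinal number with $\mu>\operatorname{wt}K$. There exists an ordinal $\alpha$ with $\alpha<\mu$ such that $\operatorname{osc}_\alpha f=\operatorname{osc}_\beta f$ for all $\beta>\alpha$. Letting $\tau$ be the least such $\alpha$, $f$ is in $D(K)$ if and only if $\operatorname{osc}_\tau f$ is bounded. When $f$ is real-valued and this occurs, then $$\|f\|_D=\bigl\|\,|f|+\operatorname{osc}_\tau f\bigr\|_\infty\qquad\text{and}\qquad\|f\|_{qD}=\|\operatorname{osc}_\tau f\|_\infty .$$ Moreover (in this case), setting $\lambda=\|\,|f|+\operatorname{osc}_\tau f\|_\infty$, $u=\frac{\lambda-\operatorname{osc}_\tau f+f}{2}$ and $v=\frac{\lambda-\operatorname{osc}_\tau f-f}{2}$, the functions $u,v$ are non-negative lower semi-continuous with $f=u-v$ and $\|f\|_D=\|u+v\|_\infty$.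
   Context: $\operatorname{wt}K$ is the smallest possible cardinality of a base for the open subsets of $K$; cardinals are identified with initial ordinals. $D(K)$ is the set of all $f:K\to\mathbb{C}$ of the form $f=(\varphi_1-\varphi_2)+i(\varphi_3-\varphi_4)$ with $\varphi_1,\dots,\varphi_4$ bounded real-valued lower semi-continuous functions on $K$. Equivalently, $f\in D(K)$ iff there is a sequence $(\varphi_j)$ of continuous complex-valued functions on $K$ with $\sup_{k\in K}\sum_j|\varphi_j(k)|<\infty$ and $f=\sum_j\varphi_j$ pointwise; $\|f\|_D$ is the infimum of $\sup_{k\in K}\sum_j|\varphi_j(k)|$ over all such sequences. $C_b(K)$ is the space of bounded continuous complex-valued functions on $K$, and for $f\in D(K)$, $\|f\|_{qD}=\inf_{\varphi\in C_b(K)}\|f-\varphi\|_D$. All $\limsup$'s are non-exclusive (the point itself is allowed). For $\varphi:K\to[-\infty,\infty]$, $U\varphi(x)=\limsup_{y\to x}\varphi(y)$. Transfinite oscillations: $\operatorname{osc}_0f\equiv0$. For an ordinal $\beta=\alpha+1$, $\widetilde{\operatorname{osc}}_\beta f(x)=\limsup_{y\to x}\bigl(|f(y)-f(x)|+\operatorname{osc}_\alpha f(y)\bigr)$; for a limit ordinal $\beta$, $\widetilde{\operatorname{osc}}_\beta f=\sup_{\alpha<\beta}\operatorname{osc}_\alpha f$; in both cases $\operatorname{osc}_\beta f=U\,\widetilde{\operatorname{osc}}_\beta f$. These functions take values in $[0,\infty]$. *)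

(* Defs.v *)
From HB Require Import structures.
From mathcomp Require Import all_boot all_order all_algebra.
From mathcomp Require Import complex.
From mathcomp Require Import all_classical all_reals all_analysis.
From mathcomp Require wochoice.

Set Implicit Arguments.
Unset Strict Implicit.
Unset Printing Implicit Defensive.

Import Order.TTheory GRing.Theory Num.Theory.
Import numFieldNormedType.Exports.

Local Open Scope classical_set_scope.
Local Open Scope complex_scope.
Local Open Scope ring_scope.

(* Ordinals are represented by well-ordered types and compared through order
   isomorphisms with initial segments, so that an ordinal has many
   representatives: equality of ordinals is [ord_iso], not [=].  [Ord] lives in
   a universe above that of its carriers, hence predicates on [Ord] are written
   [Ord -> Prop] rather than [set Ord]. *)
Record Ord := MkOrd {
  ord_carrier :> choiceType ;
  ord_rel : rel ord_carrier ;
  ord_wo : wochoice.well_order ord_rel }.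

Definition ord_below (a : Ord) (x y : a) : Prop := ord_rel x y /\ x <> y.

Definition ord_iso (a b : Ord) : Prop :=
  exists2 h : a -> b, bijective h &
    forall x y, ord_rel (h x) (h y) = ord_rel x y.

Definition ord_lt (a b : Ord) : Prop :=
  exists (h : a -> b) (z : b),
    (forall x y, ord_rel (h x) (h y) = ord_rel x y) /\
    range h = [set y | ord_below y z].

Definition ord_le (a b : Ord) : Prop := ord_lt a b \/ ord_iso a b.

Lemma void_wo : wochoice.well_order (fun _ _ : void => true).
Proof. by move=> A [[]]. Qed.

Definition ord0 : Ord := MkOrd void_wo.

Definition is_least (P : Ord -> Prop) (a : Ord) : Prop :=
  P a /\ forall b, P b -> ord_le a b.

(* A representative of the least ordinal satisfying P; junk when P is empty. *)
Definition ord_least (P : Ord -> Prop) : Ord :=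
  if pselect (exists a, is_least P a) is left h then sval (cid h) else ord0.

Definition is_cardinal (k : Ord) : Prop :=
  forall a, ord_lt a k -> ~ ([set: a] #= [set: k])%card.

Definition succ_card (k : Ord) : Ord :=
  ord_least (fun m => is_cardinal m /\ ord_lt k m).

(* Being the least ordinal equipotent to some base, this is a cardinal. *)
Definition weight (K : topologicalType) : Ord :=
  ord_least (fun k => exists2 B : set (set K), basis B & (B #= [set: k])%card).

Lemma ord_rel_anti (a : Ord) (x y : a) : ord_rel x y -> ord_rel y x -> x = y.
Proof.
move=> Rxy Ryx; have anti := @wochoice.wo_chain_antisymmetric a _ predT
  (wochoice.withinW (@ord_wo a)).
by apply: (anti x y) => //; rewrite Rxy Ryx.
Qed.

Lemma ord_rel_refl (a : Ord) (x : a) : ord_rel x x.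
Proof.
have r := @wochoice.wo_chain_reflexive a _ predT (wochoice.withinW (@ord_wo a)).
exact: (r x isT).
Qed.

Lemma ord_below_wf (a : Ord) : well_founded (@ord_below a).
Proof.
move=> x; apply: contrapT => nAx.
pose A : {pred a} := fun y => `[< ~ Acc (@ord_below a) y >].
have [|z [[/asboolP nAz lbz] _]] := ord_wo (A := A).
  by exists x; apply/asboolP.
apply: nAz; constructor => y [Ryz neq]; apply: contrapT => nAy.
have Ay : y \in A by apply/asboolP.
by apply: neq; apply: ord_rel_anti => //; exact: lbz.
Qed.

Lemma ord_rel_trans (a : Ord) : transitive (@ord_rel a).
Proof.
move=> y x z Rxy Ryz.
have [|m [[Am lbm] _]] := ord_wo (A := [pred t | [|| t == x, t == y | t == z]]).
  by exists x; rewrite inE eqxx.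
have [mx my mz] : [/\ ord_rel m x, ord_rel m y & ord_rel m z].
  by split; apply: lbm; rewrite inE eqxx ?orbT.
move: Am; rewrite inE => /or3P[/eqP E|/eqP E|/eqP E]; subst m => //.
  by rewrite (ord_rel_anti Rxy mx).
by rewrite -(ord_rel_anti Ryz my).
Qed.

Lemma initseg_wo (b : Ord) (z : b) :
  wochoice.well_order
    (fun x y : {y : b | `[< ord_below y z >]} => ord_rel (val x) (val y)).
Proof.
move=> A [x Ax].
have [|m [[/asboolP[u Au um] lb] _]] :=
    ord_wo (A := fun y : b => `[< exists2 u, u \in A & val u = y >]).
  by exists (val x); apply/asboolP; exists x.
exists u; split.
  by split => // v Av; rewrite um; apply: lb; apply/asboolP; exists v.
move=> v [Av lbv]; apply: val_inj; apply: ord_rel_anti => /=; last exact: lbv.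
by rewrite um; apply: lb; apply/asboolP; exists v.
Qed.

Definition ord_initseg (b : Ord) (z : b) : Ord := MkOrd (@initseg_wo b z).

Section oscillation.
Context {R : realType} {K : topologicalType} (f : K -> R[i]).

Local Notation normc := Normc.normc.

(* [limf_esup _ (nbhs x)] is the non-exclusive limsup at x. *)
Definition upper_env (phi : K -> \bar R) : K -> \bar R :=
  fun x => limf_esup phi (nbhs x).

Definition osc_next (g : K -> \bar R) : K -> \bar R :=
  fun x => limf_esup (fun y => (normc (f y - f x))%:E + g y)%E (nbhs x).

(* The value of osc at the order type of the initial segment P of a, given its
   values [o v] at the order types of the segments below the points v of P:
   P is empty for the ordinal 0, has a greatest element m for a successor
   (whose predecessor is the order type below m), and has none for a limit.
   Lemmas osc_zero, osc_succ and osc_limit recover the usual recursion. *)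
Definition osc_step (a : Ord) (P : set a) (o : a -> K -> \bar R) :
    K -> \bar R :=
  if pselect (P = set0) then fun=> 0%E
  else if pselect (exists m, P m /\ forall v, P v -> ord_rel v m) is left h
  then upper_env (osc_next (o (sval (cid h))))
  else upper_env (fun x => ereal_sup [set o v x | v in P]).

Definition osc_at (a : Ord) : a -> K -> \bar R :=
  Fix (@ord_below_wf a) (fun=> K -> \bar R) (fun w rec =>
    osc_step [set v | ord_below v w]
      (fun v => if pselect (ord_below v w) is left h then rec v h
                else fun=> 0%E)).

Definition osc (a : Ord) : K -> \bar R := osc_step setT (@osc_at a).

End oscillation.

Section oscillation_clauses.
Context {R : realType} {K : topologicalType} (f : K -> R[i]).

Lemma osc_step_eq (a b : Ord) (h : a -> b) (P : set a) (Q : set b) o o' :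
  (forall x y, ord_rel (h x) (h y) = ord_rel x y) -> Q = h @` P ->
  (forall x, P x -> o' (h x) = o x) ->
  osc_step f Q o' = osc_step f P o.
Proof.
move=> hmono -> oo'; rewrite /osc_step.
case: (pselect (_ = _)) => [hP0|hP0]; case: (pselect (P = set0)) => P0' //=.
- case: P0'; rewrite -subset0 => x Px; have : (h @` P) (h x) by exists x.
  by rewrite hP0.
- by case: hP0; rewrite P0' image_set0.
case: pselect => [h1|n1]; case: pselect => [h2|n2].
- congr (upper_env (osc_next _ _)).
  case: (cid h1) => /= _ [[m Pm <-] mmax].
  case: (cid h2) => /= m' [Pm' m'max].
  rewrite oo' //; congr o; apply: ord_rel_anti; first exact: m'max.
  by rewrite -hmono; apply: mmax; exists m'.
- case: n2; case: h1 => _ [[m Pm <-] mmax]; exists m; split=> // v Pv.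
  by rewrite -hmono; apply: mmax; exists v.
- case: n1; case: h2 => m [Pm mmax]; exists (h m); split; first by exists m.
  by move=> _ [v Pv <-]; rewrite hmono; exact: mmax.
- congr upper_env; apply/funext => x; congr ereal_sup.
  apply/seteqP; split => y.
    by move=> [_ [v Pv <-] <-]; exists v => //; rewrite oo'.
  by move=> [v Pv <-]; exists (h v); [exists v | rewrite oo'].
Qed.

Lemma osc_atE (a : Ord) (w : a) :
  osc_at f w = osc_step f [set v | ord_below v w] (@osc_at _ _ f a).
Proof.
rewrite [LHS]/osc_at Fix_eq; last first.
  move=> x g g' gg'; congr (osc_step _ _); apply/funext => v.
  by case: pselect.
apply: (@osc_step_eq _ _ id) => //=; first by rewrite image_id.
by move=> x xw; case: pselect.
Qed.

Lemma osc_at_segment (a b : Ord) (h : a -> b) (P : set b) :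
  (forall x y, ord_rel (h x) (h y) = ord_rel x y) -> range h = P ->
  (forall x y, P y -> ord_below x y -> P x) ->
  forall x, osc_at f (h x) = osc_at f x.
Proof.
move=> hmono rh Pinit x.
elim/(well_founded_ind (@ord_below_wf a)): x => x IH.
have inj u v : h u = h v -> u = v.
  by move=> e; apply: ord_rel_anti; rewrite -hmono e ord_rel_refl.
rewrite !osc_atE; apply: (osc_step_eq hmono) => [|y]; last exact: IH.
apply/seteqP; split => y /=.
  move=> yx; have : P y by apply: Pinit yx; rewrite -rh; exists x.
  rewrite -rh => -[z _ zy]; exists z => //; subst y.
  by case: yx; rewrite hmono => ? ne; split => // zx; apply: ne; rewrite zx.
move=> [z [zx ne] <-]; split; first by rewrite hmono.
by move=> /inj.
Qed.

Lemma osc_lt (a b : Ord) (h : a -> b) z :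
  (forall x y, ord_rel (h x) (h y) = ord_rel x y) ->
  range h = [set y | ord_below y z] -> osc f a = osc_at f z.
Proof.
move=> hmono rh; rewrite osc_atE; apply/esym.
apply: (osc_step_eq hmono) => // x _.
apply: (osc_at_segment hmono rh) => {x} x y /= [yz ne] [xy nexy].
split; first exact: ord_rel_trans xy yz.
by move=> e; apply: nexy; apply: ord_rel_anti => //; rewrite e.
Qed.

Lemma osc_iso (a b : Ord) : ord_iso a b -> osc f a = osc f b.
Proof.
move=> [h [g hK gK] hmono]; apply/esym; apply: (osc_step_eq hmono) => [|x _].
  by apply/seteqP; split => // y _; exists (g y).
by apply: (osc_at_segment hmono (erefl _)) => u v _ _; exists (g u).
Qed.

Lemma osc_zero (a : Ord) : (a -> False) -> osc f a = fun=> 0%E.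
Proof.
move=> a0; rewrite /osc /osc_step; case: pselect => // -[].
by apply/seteqP; split => // x; case: (a0 x).
Qed.

Lemma osc_succ (a b : Ord) (h : a -> b) (m : b) :
  (forall x y, ord_rel (h x) (h y) = ord_rel x y) ->
  range h = [set y | y <> m] -> (forall y, ord_rel y m) ->
  osc f b = upper_env (osc_next f (osc f a)).
Proof.
move=> hmono rh mmax; have -> : osc f a = osc_at f m.
  apply: (osc_lt hmono); rewrite rh; apply/seteqP; split => y //=.
  by case.
rewrite /osc /osc_step; case: (pselect (_ = _)) => [T0|_] /=.
  by have : [set: b] m by []; rewrite T0.
case: pselect => [h1|[]]; last by exists m.
case: (cid h1) => m' [_ /= m'max]; congr (upper_env (osc_next _ (osc_at _ _))).
by apply: ord_rel_anti => //; exact: m'max.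
Qed.

Lemma osc_initseg (b : Ord) (z : b) :
  ord_lt (ord_initseg z) b /\ osc f (ord_initseg z) = osc_at f z.
Proof.
pose h (y : ord_initseg z) : b := val y.
have hm (x y : ord_initseg z) : ord_rel (h x) (h y) = ord_rel x y by [].
have r : range h = [set y | ord_below y z].
  apply/seteqP; split => y /=.
    by move=> [[u hu] _ <-]; exact: (asboolW hu).
  by move=> yz; exists (exist _ y (asboolT yz)).
split; last exact: (osc_lt hm).
by exists h, z.
Qed.

Lemma osc_limit (b : Ord) : (exists z : b, True) ->
  (forall m : b, exists z : b, ord_below m z) ->
  osc f b = upper_env (fun x =>
    ereal_sup [set y | exists2 a, ord_lt a b & y = osc f a x]).
Proof.
move=> [z0 _] nomax; rewrite /osc /osc_step.
case: (pselect (_ = _)) => [T0|_] /=.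
  by have : [set: b] z0 by []; rewrite T0.
case: pselect => [h1|_].
  exfalso; case: h1 => m [_ mmax]; have [z [mz ne]] := nomax m.
  by case: ne; apply: ord_rel_anti => //; apply: mmax.
congr upper_env; apply/funext => x; congr ereal_sup; apply/seteqP; split => y.
  by move=> [v _ <-]; have [? <-] := osc_initseg v; eexists; eauto.
by move=> [a [h [z [hm hr]]] ->]; exists z => //; rewrite -(osc_lt hm hr).
Qed.

End oscillation_clauses.

Section D_space.
Context {R : realType} {K : topologicalType}.

Local Notation normc := Normc.normc.

Definition bounded_lsc (phi : K -> R) : Prop :=
  (exists M : R, forall x, `|phi x| <= M) /\
  lower_semicontinuous (EFin \o phi).

Definition in_D (f : K -> R[i]) : Prop :=
  exists phi1 phi2 phi3 phi4 : K -> R,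
    [/\ bounded_lsc phi1, bounded_lsc phi2, bounded_lsc phi3, bounded_lsc phi4
      & forall x, f x = (phi1 x - phi2 x)%:C + 'i * (phi3 x - phi4 x)%:C].

Definition abs_sum_sup (phi : nat -> K -> R[i]) : \bar R :=
  ereal_sup (range (fun k => (\sum_(0 <= j <oo) (normc (phi j k))%:E)%E)).

(* Convergence is for the norm topology of C, carried here by R[i]^o. *)
Definition represents (phi : nat -> K -> R[i]) (f : K -> R[i]) : Prop :=
  [/\ forall j, continuous (phi j : K -> R[i]^o),
      (abs_sum_sup phi < +oo)%E
    & forall k, series (fun j => phi j k : R[i]^o) @ \oo --> (f k : R[i]^o)].

Definition D_norm (f : K -> R[i]) : \bar R :=
  ereal_inf [set abs_sum_sup phi | phi in [set phi | represents phi f]].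

Definition Cb : set (K -> R[i]) :=
  [set phi | continuous (phi : K -> R[i]^o) /\ exists M : R, forall x, normc (phi x) <= M].

Definition qD_norm (f : K -> R[i]) : \bar R :=
  ereal_inf [set D_norm (fun x => f x - phi x) | phi in Cb].

Definition sup_norm (g : K -> \bar R) : \bar R :=
  ereal_sup (range (fun x => `|g x|%E)).

End D_space.

(* Main.v *)
(** Write [o] for the final oscillation of [f].  The oscillations are upper
    semicontinuous and increase with the ordinal.  While they have not
    stabilized, each step is witnessed by a basic open set and a rational [q]
    (the function is [< q] on the set, but its successor is [> q] at one of its
    points), and distinct steps have distinct witnesses; so stabilization occurs
    before any ordinal of cardinality greater than [wt K].

    The limit satisfies [limsup_(y -> x) (|f y - f x| + o y) <= o x], which says
    precisely that [- o + g] and [- o - g] are lower semicontinuous when [f = g]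
    is real.  Conversely every real [h >= 0] with
    [limsup_(y -> x) (|f y - f x| + h y) <= h x] lies above all oscillations.
    This applies to [h = M - sum_j |phi_j|] whenever [f - psi = sum_j phi_j] with
    [psi] and all [phi_j] continuous and [sum_j |phi_j| <= M], and yields the
    lower bounds for both norms.  For the upper bounds, nonnegative lower
    semicontinuous functions on a metric space are increasing limits of
    continuous ones, so that [||u - v||_D <= sup (u + v)]; for the quotient norm
    one subtracts from [g] a continuous function inserted (up to [e]) between
    [g + o - L] and [g - o + L], where [L = sup o]. *)

Require Import Defs.
From mathcomp Require Import all_boot all_order all_algebra.
From mathcomp Require Import complex.
From mathcomp Require Import all_classical all_reals all_analysis.
From mathcomp Require Import ring lra.

Import Order.TTheory GRing.Theory Num.Theory.
Import numFieldNormedType.Exports.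

Local Open Scope classical_set_scope.
Local Open Scope complex_scope.
Local Open Scope ring_scope.

Set Implicit Arguments.
Unset Strict Implicit.
Unset Printing Implicit Defensive.

(** * Ordinals and cardinals *)

Lemma ord_rel_total (a : Ord) (x y : a) : ord_rel x y \/ ord_rel y x.
Proof.
have := @wochoice.wo_chainW a _ predT (wochoice.withinW (@ord_wo a)).
by move=> /(_ x y isT isT) /orP.
Qed.

Lemma ord_below_trich (a : Ord) (x y : a) :
  [\/ ord_below x y, x = y | ord_below y x].
Proof.
have [->|ne] := pselect (x = y); first by constructor 2.
by have [h|h] := ord_rel_total x y; [constructor 1|constructor 3]; split=> // e;
  exact: ne.
Qed.

Lemma ord_belowN (a : Ord) (x y : a) : ord_below x y -> ~ ord_rel y x.
Proof. by move=> [xy ne] yx; apply: ne; exact: ord_rel_anti. Qed.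

Lemma ord_below_le_trans (a : Ord) (x y z : a) :
  ord_below x y -> ord_rel y z -> ord_below x z.
Proof.
move=> [xy ne] yz; split; first exact: ord_rel_trans xy yz.
by move=> e; apply: ne; apply: ord_rel_anti => //; rewrite e.
Qed.

Lemma ord_min (a : Ord) (A : set a) : A !=set0 ->
  exists z, A z /\ forall y, A y -> ord_rel z y.
Proof.
move=> [x Ax]; have [|z [[/asboolP Az lb] _]] :=
    @ord_wo a (fun y : a => `[< A y >]).
  by exists x; apply/asboolP.
by exists z; split=> // y Ay; apply: lb; exact/asboolP.
Qed.

Lemma ord_mono (a b : Ord) (k : a -> b) :
  (forall x y, ord_below x y -> ord_below (k x) (k y)) ->
  forall x y, ord_rel (k x) (k y) = ord_rel x y.
Proof.
move=> km x y; have [h|->|h] := ord_below_trich x y.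
- by rewrite (proj1 h) (proj1 (km _ _ h)).
- by rewrite !ord_rel_refl.
- by rewrite (negbTE (introN idP (ord_belowN h)))
    (negbTE (introN idP (ord_belowN (km _ _ h)))).
Qed.

(* An order isomorphism onto an initial segment of one of the two ordinals is
   built by sending x to the least element not yet attained. *)
Lemma ord_trich (a b : Ord) : [\/ ord_lt a b, ord_iso a b | ord_lt b a].
Proof.
pose least (A : set b) : option b :=
  if pselect (exists z, A z /\ forall y, A y -> ord_rel z y) is left e
  then Some (sval (cid e)) else None.
pose h : a -> option b := Fix (@ord_below_wf a) (fun=> option b)
  (fun x rec => least
    [set y | forall x' (H : ord_below x' x), rec x' H <> Some y]).
pose A x := [set y | forall x', ord_below x' x -> h x' <> Some y].
have hE x : h x = least (A x).
  rewrite /h Fix_eq // => {}x g g' gg'; congr least; apply/seteqP.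
  by split=> y /= Hy x' H; have := Hy x' H; rewrite gg'.
have hS x y : h x = Some y -> A x y /\ forall y', A x y' -> ord_rel y y'.
  by rewrite hE /least; case: pselect => // e [<-]; case: (cid e).
have hN x : h x = None -> forall y, exists2 x', ord_below x' x & h x' = Some y.
  rewrite hE /least; case: pselect => // e _ y.
  apply: contrapT => ny; apply: e; apply: ord_min; exists y => x' x'x hx'.
  by apply: ny; exists x'.
have hseg x y y' : h x = Some y -> ord_below y' y ->
    exists2 x', ord_below x' x & h x' = Some y'.
  move=> /hS[_ lb] y'y; apply: contrapT => ny'; apply: (ord_belowN y'y).
  by apply: lb => x' x'x hx'; apply: ny'; exists x'.
have hm x y x' y' : h x = Some y -> h x' = Some y' -> ord_below x x' ->
    ord_below y y'.
  move=> hx /hS[Ay' _] xx'; split; last by move=> yy'; apply: (Ay' x); rewrite ?hx ?yy'.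
  have [_] := hS _ _ hx; apply => z zx; apply: Ay'.
  by apply: ord_below_le_trans zx (proj1 xx').
(* [h x = None] means that the values before [x] exhaust [b]; inverting [h] below the least such [z]
   maps [b] onto the segment below [z]. *)
have [[x0 hx0]|nN] := pselect (exists x, h x = None).
  have [z [hz zmin]] := @ord_min a [set x | h x = None] (ex_intro _ x0 hx0).
  have /choice[g gP] : forall y, exists x, ord_below x z /\ h x = Some y.
    by move=> y; have [x xz hx] := hN _ hz y; exists x.
  constructor 3; exists g, z; split.
    apply: ord_mono => y y' yy'; have [_ hx] := gP y; have [_ hx'] := gP y'.
    have [//|e|h'] := ord_below_trich (g y) (g y').
      by move: hx'; rewrite -e hx => -[e']; case: yy'; rewrite e'.
    by case: (ord_belowN (hm _ _ _ _ hx' hx h')); case: yy'.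
  apply/seteqP; split=> [x [y _ <-]|x xz]; first by case: (gP y).
  case hx: (h x) => [y|]; last by case: (ord_belowN xz); exact: zmin.
  exists y => //; have [_ hx'] := gP y.
  have [h'|//|h'] := ord_below_trich x (g y).
    by case: (hm _ _ _ _ hx hx' h').
  by case: (hm _ _ _ _ hx' hx h').
have /choice[k hk] : forall x, exists y, h x = Some y.
  by move=> x; case hx: (h x) => [y|]; [exists y | case: nN; exists x].
have km : forall x y, ord_rel (k x) (k y) = ord_rel x y.
  by apply: ord_mono => x y; apply: hm.
have [kT|] := pselect (range k = setT).
  have /choice[g gk] : forall y, exists x, k x = y.
    by move=> y; have : range k y by [rewrite kT]; move=> [x _ <-]; exists x.
  constructor 2; exists k => //; exists g => // x.
  by apply: ord_rel_anti; rewrite -km gk ord_rel_refl.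
move=> kT; have /ord_min[z [nz zmin]] : ~` range k !=set0.
  by apply/set0P/negP => /eqP; rewrite -setCT => /setC_inj.
constructor 1; exists k, z; split=> //; apply/seteqP; split.
  move=> _ [x _ <-]; have [//|e|h'] := ord_below_trich (k x) z.
    by case: nz; rewrite -e; exists x.
  have [x' _] := hseg _ _ _ (hk x) h'.
  by rewrite hk => -[e]; case: nz; exists x'.
move=> y yz; apply: contrapT => ny; exact: (ord_belowN yz (zmin _ ny)).
Qed.

(** Minima exist inside one well-order only, so the search takes place in some [a] satisfying [P]:
    among the members of [P] isomorphic to a proper initial segment of [a], take one with least end
    point; if there are none, [a] itself is minimal. *)
Lemma ord_least_exists (P : Ord -> Prop) : (exists a, P a) ->
  exists m, is_least P m /\ forall b, P b -> ~ ord_lt b m.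
Proof.
move=> [a Pa]; pose emb (b : Ord) (z : a) := exists h : b -> a,
  (forall x y, ord_rel (h x) (h y) = ord_rel x y) /\
  range h = [set y | ord_below y z].
pose Q z := exists2 b, P b & emb b z.
suff [m Pm mlt] : exists2 m, P m & forall b, P b -> ~ ord_lt b m.
  exists m; split=> //; split=> // b Pb; have [||h] := ord_trich m b.
  - by left.
  - by right.
  - by case: (mlt b).
have [[z0 /(ex_intro _ _)/(@ord_min a Q)]|nQ] := pselect (exists z, Q z); last first.
  by exists a => // b Pb [h [z hz]]; apply: nQ; exists z, b => //; exists h.
move=> [z [[m Pm [h [hm hr]]] zmin]].
exists m => // b Pb [k [w [km kr]]].
have hw : ord_below (h w) z by have : range h (h w) by [exists w]; rewrite hr.
apply: (ord_belowN hw); apply: zmin; exists b => //; exists (h \o k); split.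
  by move=> x y; rewrite /= hm.
apply/seteqP; split=> [_ [x _ <-]|y /= [yz ne]].
  have : range k (k x) by exists x.
  rewrite kr => -[kxw kxne]; split; first by rewrite /= hm.
  by move=> /= e; apply: kxne; apply: ord_rel_anti; rewrite -hm e ord_rel_refl.
have : range h y by rewrite hr; exact: ord_below_le_trans (conj yz ne) (proj1 hw).
move=> [u _ e]; have : range k u.
  by rewrite kr; split; [rewrite -hm e | move=> uw; apply: ne; rewrite -e uw].
by move=> [x _ xu]; exists x => //=; rewrite xu.
Qed.

Lemma ord_leastP (P : Ord -> Prop) : (exists a, P a) -> is_least P (ord_least P).
Proof.
move=> /ord_least_exists[m [mP _]]; rewrite /ord_least.
by case: pselect => [h|[]]; [case: (cid h) | exists m].
Qed.

(** * Cardinality: successor cardinals, the weight, and countable multiples of an infinite set *)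

Lemma ord_of_type (T : choiceType) : exists a : Ord, ([set: a] #= [set: T])%card.
Proof.
by have [r rwo] := wochoice.well_ordering_principle T; exists (MkOrd rwo).
Qed.

Lemma card_le_injP (T U : Type) :
  ([set: T] #<= [set: U])%card <-> exists f : T -> U, injective f.
Proof.
split=> [/card_leP[f]|[f finj]].
  exists (fun x => val (f (to_setT x))) => x y /val_inj.
  by move=> /(inj (in_setT _) (in_setT _)) [].
suff /injfunPex[g] : exists2 f : T -> U, set_fun setT setT f & set_inj setT f.
  exact: inj_card_le.
by exists f => // x y _ _; exact: finj.
Qed.

Lemma ord_lt_card_le (a b : Ord) : ord_lt a b -> ([set: a] #<= [set: b])%card.
Proof.
move=> [h [z [hm _]]]; apply/card_le_injP; exists h => x y e.
by apply: ord_rel_anti; rewrite -hm e ord_rel_refl.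
Qed.

(** Cantor's diagonal argument for an injection [f]: the value [f D] lies in [D] exactly when it
    does not. *)
Lemma card_set_not_le (T : Type) : ~ ([set: set T] #<= [set: T])%card.
Proof.
move=> /card_le_injP[f finj]; pose D := [set f A | A in [set A | ~ A (f A)]].
have nD : ~ D (f D) by move=> /[dup] DfD [A nA /finj e]; apply: nA; rewrite e.
by apply: (nD); exists D.
Qed.

(** The minimum defining [succ_card] is not junk: the least ordinal equipotent to the power set of
    [k] is a cardinal, and Cantor's theorem puts it above [k]. *)
Lemma succ_cardP (k : Ord) :
  is_cardinal (succ_card k) /\ ord_lt k (succ_card k).
Proof.
apply: (proj1 (@ord_leastP (fun m => is_cardinal m /\ ord_lt k m) _)).
have [m [[mk _] mmin]] := @ord_least_exists
  (fun a => [set: a] #= [set: set k])%card (@ord_of_type (set k : choiceType)).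
exists m; split.
  by move=> a am ea; apply: (mmin a) => //; exact: card_eq_trans mk.
have nle : ~ ([set: set k] #<= [set: k])%card by exact: card_set_not_le.
have [//|[h hb _]|/ord_lt_card_le] := ord_trich k m.
- case: nle; rewrite -(card_le_eql mk); apply/card_le_injP.
  by have [g gK hK] := hb; exists g; exact: can_inj hK.
- by rewrite (card_le_eql mk).
Qed.

Lemma succ_card_not_le (k : Ord) : ~ ([set: succ_card k] #<= [set: k])%card.
Proof.
have [mcard km] := succ_cardP k => le.
by apply: (mcard _ km); apply: Cantor_Bernstein => //; exact: ord_lt_card_le.
Qed.

Lemma weightP (K : topologicalType) :
  exists2 B : set (set K), basis B & (B #= [set: weight K])%card.
Proof.
apply: (proj1 (@ord_leastP
  (fun k => exists2 B : set (set K), basis B & (B #= [set: k])%card) _)).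
have [k kP] := ord_of_type (set_type (@open K) : choiceType).
exists k, open; last by rewrite card_eq_sym (card_eql kP) card_setT.
split=> // x A; rewrite nbhsE => -[U [oU Ux] UA]; exists U => //.
Qed.

(** Zorn's lemma gives a maximal family [F] of injective sequences with disjoint ranges, which
    misses only finitely many points. Hence [T] injects into pairs of a sequence in [F] and an
    index, and a pairing of indices absorbs the extra factor. *)
Lemma infinite_card_setX_nat (T : Type) : infinite_set [set: T] ->
  ([set: T * nat] #<= [set: T])%card.
Proof.
move=> Tinf.
pose disj (F : set (nat -> T)) := forall s t i j, F s -> F t -> s i = t j ->
  s = t /\ i = j.
have [F [Fd Fmax]] : exists F, disj F /\ forall G, F `<` G -> ~ disj G.
  apply: Zorn_bigcup => G Gd Gtot s t i j [X GX Xs] [Y GY Yt].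
  have [XY|YX] := Gtot _ _ GX GY.
    by apply: (Gd _ GY) => //; exact: XY.
  by apply: (Gd _ GX) => //; exact: YX.
pose C := [set s.1 s.2 | s in [set s : (nat -> T) * nat | F s.1]].
have Cfin : finite_set (~` C).
  apply: contrapT => /infiniteP; rewrite -(card_le_eqr (card_setT _)).
  move=> /card_le_injP[e einj]; pose s n := val (e n).
  have nCs n : ~ C (s n) by rewrite /s; have /set_mem := valP (e n).
  have sinj i j : s i = s j -> i = j by move=> /val_inj/einj.
  apply: (Fmax (F `|` [set s])).
    split=> [|sub]; first exact: subsetUl.
    by apply: (nCs 0%N); exists (s, 0%N) => //=; apply: sub; right.
  move=> u t i j [Fu|->] [Ft|->]; first exact: Fd.
  - by move=> e'; case: (nCs j); exists (u, i).
  - by move=> e'; case: (nCs i); exists (t, j).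
  - by move=> /sinj.
have /countable_injP[r rinj] := finite_set_countable Cfin.
have [s0 Fs0] : F !=set0.
  apply/set0P/negP => /eqP F0; apply: Tinf; suff <- : ~` C = setT by [].
  by rewrite -subTset => x _ [p /=]; rewrite F0.
have [g gP] : exists g : T -> (nat -> T) * nat,
    injective g /\ forall x, F (g x).1.
  have /choice[d dP] : forall x, exists p : (nat -> T) * nat,
      C x -> F p.1 /\ p.1 p.2 = x.
    by move=> x; have [[p Fp px]|nC] := pselect (C x);
      [exists p | exists (s0, 0%N)].
  (* Points covered by [F] get even indices; the odd indices of [s0] host the finitely many points
     left over. *)
  exists (fun x => if pselect (C x) then ((d x).1, (d x).2.*2)
    else (s0, (r x).*2.+1)); split=> [x y|x]; last first.
    by case: pselect => //= /dP[].
  case: pselect => Cx; case: pselect => Cy // [].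
  - move=> e1 /double_inj e2.
    by have [_ <-] := dP x Cx; have [_ <-] := dP y Cy; rewrite e1 e2.
  - by move=> _ /(congr1 odd); rewrite /= !odd_double.
  - by move=> _ /(congr1 odd); rewrite /= !odd_double.
  - by move=> /double_inj; apply: rinj; exact/mem_set.
case: gP => ginj gF; apply/card_le_injP.
exists (fun p => (g p.1).1 (choice.pickle ((g p.1).2, p.2))) => -[x n] [y m] /=.
move=> /(Fd _ _ _ _ (gF x) (gF y))[e1 /(pcan_inj (@choice.pickleK _))[e2 ->]].
by congr pair; apply: ginj; exact: injective_projections.
Qed.

(** In a Hausdorff space a point is determined by the basic sets containing it, and a finite base
    allows only finitely many such codes. *)
Lemma hausdorff_basis_infinite (K : topologicalType) (B : set (set K)) :
  hausdorff_space K -> infinite_set [set: K] -> basis B -> infinite_set B.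
Proof.
move=> Khaus Kinf [_ Bb] [n /card_esym/card_bijP[h [g hK gK]]]; apply: Kinf.
pose code (x : K) : {ffun 'I_n -> bool} :=
  [ffun i : 'I_n => `[< val (h (SigSub (mem_set (ltn_ord i : `I_n i)))) x >]].
have codeinj : injective code.
  move=> x y exy; apply: Khaus => U V Ux Vy.
  have [A [BA Ax] AU] := Bb x U Ux.
  exists y; split; last exact: nbhs_singleton.
  apply: AU => /=.
  have [z hz] : exists z, h z = SigSub (mem_set BA) by exists (g (SigSub (mem_set BA))).
  have zn : (val z < n)%N by have /set_mem := valP z.
  have := congr1 (fun c : {ffun 'I_n -> bool} => c (Ordinal zn)) exy.
  rewrite !ffunE; set z' := SigSub _; have -> : z' = z by exact: val_inj.
  by rewrite hz /= => e; apply/asboolP; rewrite -e; exact/asboolP.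
apply: (@card_le_finite _ _ _ [set: {ffun 'I_n -> bool}]); last exact: finite_finset.
by apply/card_le_injP; exists code.
Qed.

(** * Oscillations and their stabilization *)

Section limsup.
Context {R : realType} {K : topologicalType}.
Implicit Types (phi psi : K -> \bar R) (x : K) (c : \bar R).
Local Open Scope ereal_scope.

Lemma limsup_le phi x c : (\forall y \near x, phi y <= c) ->
  limf_esup phi (nbhs x) <= c.
Proof.
move=> h; apply: (@le_trans _ _ (ereal_sup (phi @` [set y | phi y <= c]))).
  by apply: ereal_inf_lbound; exists [set y | phi y <= c].
by apply: ge_ereal_sup => _ [y hy <-].
Qed.

Lemma limsup_lt phi x c : limf_esup phi (nbhs x) < c ->
  \forall y \near x, phi y < c.
Proof.
move=> /ereal_inf_lt[_ [V xV <-] Vc]; apply: filterS xV => y Vy.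
by apply: le_lt_trans Vc; apply: ereal_sup_ubound; exists y.
Qed.

Lemma limsup_ge phi x : phi x <= limf_esup phi (nbhs x).
Proof.
apply: le_ereal_inf_tmp => _ [V xV <-]; apply: ereal_sup_ubound.
by exists x => //; exact: nbhs_singleton.
Qed.

Lemma limsup_mono phi psi x : (forall y, phi y <= psi y) ->
  limf_esup phi (nbhs x) <= limf_esup psi (nbhs x).
Proof.
move=> h; apply: le_ereal_inf_tmp => _ [V xV <-].
apply: (@le_trans _ _ (ereal_sup (phi @` V))).
  by apply: ereal_inf_lbound; exists V.
apply: ge_ereal_sup => _ [y Vy <-]; apply: (le_trans (h y)).
by apply: ereal_sup_ubound; exists y.
Qed.

Lemma upper_env_usc phi x c : upper_env phi x < c ->
  \forall y \near x, upper_env phi y < c.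
Proof.
move=> /ereal_inf_lt[_ [V xV <-] Vc].
have : \forall y \near x, nbhs y V by exact: nbhs_interior.
apply: filterS => y yV; apply: le_lt_trans Vc.
by apply: ereal_inf_lbound; exists V.
Qed.

End limsup.

Section osc_theory.
Context {R : realType} {K : topologicalType} (f : K -> R[i]).
Local Open Scope ereal_scope.

(** The successor step of the recursion; the oscillations stop growing at its fixed points. *)
Definition osc_op (g : K -> \bar R) := upper_env (osc_next f g).

Lemma osc_op_ge g x : g x <= osc_op g x.
Proof.
apply: le_trans (limsup_ge _ _); apply: le_trans (limsup_ge _ _).
by rewrite subrr Normc.normc0 add0e.
Qed.

Lemma osc_op_mono g h : (forall x, g x <= h x) ->
  forall x, osc_op g x <= osc_op h x.
Proof.
move=> gh x; apply: limsup_mono => y; apply: limsup_mono => z.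
by rewrite leeD2l.
Qed.

(** Transfinite induction over zero, successor and limit steps, freed from the encoding of
    ordinals. *)
Lemma osc_step_ind (P : (K -> \bar R) -> Prop) :
  P (fun=> 0) -> (forall g, P g -> P (osc_op g)) ->
  (forall G : set (K -> \bar R), G !=set0 -> G `<=` P ->
    P (upper_env (fun x => ereal_sup [set g x | g in G]))) ->
  forall a : Ord, P (osc f a).
Proof.
move=> P0 Pop Psup a.
have step (S : set a) : (forall v, S v -> P (osc_at f v)) ->
    P (osc_step f S (@osc_at _ _ f a)).
  move=> PS; rewrite /osc_step; case: pselect => //= S0.
  case: pselect => [h|_]; first by apply/Pop/PS; case: (cid h) => ? [].
  rewrite (_ : (fun x => _) = (fun x => ereal_sup
      [set g x | g in [set osc_at f v | v in S]])).
    apply: Psup => [|_ [v Sv <-]]; last exact: PS.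
    by have /set0P[v Sv] := introN eqP S0; exists (osc_at f v), v.
  by apply/funext => x; rewrite image_comp.
suff Pat (v : a) : P (osc_at f v) by exact: (step setT (fun v _ => Pat v)).
elim/(well_founded_ind (@ord_below_wf a)): v => v IH.
by rewrite osc_atE; apply: step.
Qed.

Lemma osc_ge0 a x : 0 <= osc f a x.
Proof.
move: a x; apply: (@osc_step_ind (fun g => forall x, 0 <= g x)) => [//|g g0 x|G [g Gg] G0 x].
  exact: le_trans (g0 x) (osc_op_ge g x).
apply: le_trans (limsup_ge _ _); apply: le_trans (G0 g Gg x) _.
by apply: ereal_sup_ubound; exists g.
Qed.

Lemma osc_usc a x c : osc f a x < c -> \forall y \near x, osc f a y < c.
Proof.
move: a x c; apply: (@osc_step_ind (fun g => forall x c, g x < c ->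
  \forall y \near x, g y < c)) => [x c c0|g _ x c|G _ _ x c].
- exact: filterE.
- exact: upper_env_usc.
- exact: upper_env_usc.
Qed.

(** Successor steps use that [osc_op] is monotone. At a limit, the supremum stays below
    [h <= osc_next f h], so its upper envelope is below [osc_op f h <= h]. *)
Lemma osc_le (h : K -> \bar R) : (forall x, 0 <= h x) ->
  (forall x, osc_op h x <= h x) -> forall a x, osc f a x <= h x.
Proof.
move=> h0 hop; apply: (@osc_step_ind (fun g => forall x, g x <= h x)) => [//|g gh x|G _ Gh x].
  exact: le_trans (osc_op_mono gh x) (hop x).
apply: le_trans (hop x); apply: limsup_mono => y; apply: ge_ereal_sup.
move=> _ [g Gg <-]; apply: le_trans (Gh g Gg y) _; apply: le_trans (limsup_ge _ _).
by rewrite subrr Normc.normc0 add0e.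
Qed.

Lemma osc_step_ge (a : Ord) (S : set a) z : S z ->
  (forall v, S v -> ord_below z v ->
    forall x, osc_op (osc_at f z) x <= osc_at f v x) ->
  forall x, osc_op (osc_at f z) x <= osc_step f S (@osc_at _ _ f a) x.
Proof.
move=> Sz IH x; rewrite /osc_step; case: pselect => [S0|_] /=.
  by move: Sz; rewrite S0.
case: pselect => [h|nmax] /=.
  case: (cid h) => m /= [Sm mmax].
  have [->//|zm] := pselect (z = m).
  apply: le_trans (osc_op_ge _ _); apply: IH => //; split=> //; exact: mmax.
have [v Sv zv] : exists2 v, S v & ord_below z v.
  apply: contrapT => nv; apply: nmax; exists z; split=> // v Sv.
  have [[]//|->|zv] := ord_below_trich v z; first exact: ord_rel_refl.
  by case: nv; exists v.
apply: le_trans (IH v Sv zv x) _; apply: le_trans (limsup_ge _ _).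
by apply: ereal_sup_ubound; exists v.
Qed.

Lemma osc_at_mono (a : Ord) (z w : a) : ord_below z w ->
  forall x, osc_op (osc_at f z) x <= osc_at f w x.
Proof.
elim/(well_founded_ind (@ord_below_wf a)): w => w IH zw x.
by rewrite (osc_atE f w); apply: osc_step_ge => // v vw zv y; exact: IH.
Qed.

Lemma osc_lt_mono (a b : Ord) : ord_lt a b ->
  forall x, osc_op (osc f a) x <= osc f b x.
Proof.
move=> [h [z [hm hr]]] x; rewrite (osc_lt f hm hr).
by apply: osc_step_ge => // v _ zv; exact: osc_at_mono.
Qed.

(** By [osc_le], a fixed point bounds all the oscillations; the other inequality is monotonicity. *)
Lemma osc_stable (a : Ord) : osc_op (osc f a) = osc f a ->
  forall b, ord_lt a b -> osc f a = osc f b.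
Proof.
move=> fixa b ab; apply/funext => x; apply/eqP; rewrite eq_le.
rewrite -{1}fixa osc_lt_mono //=; apply: osc_le => [y|y].
  exact: osc_ge0.
by rewrite fixa.
Qed.

End osc_theory.

(** Without a fixed point below [mu], sending [z] to its witness (a basic set and a rational) would
    inject [mu] into [B * nat], which is no larger than the weight. *)
Lemma osc_fixpoint_exists (R : realType) (K : metricType R) (f : K -> R[i]) :
  infinite_set [set: K] ->
  exists a, ord_lt a (succ_card (weight K)) /\ osc_op f (osc f a) = osc f a.
Proof.
move=> Kinf; set mu := succ_card _.
have [B Bbasis Bw] := weightP K.
have Binf := hausdorff_basis_infinite (@metric_hausdorff R K) Kinf Bbasis.
suff [z fz] : exists z : mu, osc_op f (osc_at f z) = osc_at f z.
  by have [ltz e] := osc_initseg f z; exists (ord_initseg z); rewrite e.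
apply: contrapT => /forallNP nfix; apply: (@succ_card_not_le (weight K)).
rewrite -(card_le_eqr Bw) -(card_le_eqr (card_setT B)).
apply: (card_le_trans _ (infinite_card_setX_nat _)); last first.
  by rewrite (eq_finite_set (card_setT B)).
have gap (z : mu) : exists p : B * rat, exists x, [/\ val p.1 x,
    (forall y, val p.1 y -> (osc_at f z y < (ratr p.2)%:E)%E) &
    ((ratr p.2)%:E < osc_op f (osc_at f z) x)%E].
  have [x xz] : exists x, (osc_at f z x < osc_op f (osc_at f z) x)%E.
    apply: contrapT => /forallNP nlt; apply: (nfix z); apply/funext => x.
    by apply/eqP; rewrite eq_le osc_op_ge andbT leNgt; apply/negP; exact: nlt.
  have [q q1 q2] : exists2 q : rat, (osc_at f z x < (ratr q)%:E)%E &
      ((ratr q)%:E < osc_op f (osc_at f z) x)%E.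
    have : (0 <= osc_at f z x)%E.
      by have [_ <-] := osc_initseg f z; exact: osc_ge0.
    move: xz; case: (osc_at f z x) => [r| |] //; last first.
      by rewrite ltNge leey.
    case: (osc_op _ _ x) => [s| |]; last by rewrite ltNge leNye.
      rewrite lte_fin => /rat_in_itvoo[q]; rewrite in_itv => /andP[rq qs] _.
      by exists q; rewrite lte_fin.
    move=> _ _; have /rat_in_itvoo[q] : (r < r + 1)%R by rewrite ltrDl.
    by rewrite in_itv => /andP[rq _]; exists q; rewrite ?lte_fin ?ltry.
  have := osc_usc (f := f) (a := ord_initseg z) (x := x).
  have [_ ->] := osc_initseg f z => /(_ _ q1) nq.
  have [_ /(_ x _ nq)[U [BU Ux] Uq]] := Bbasis.
  by exists (SigSub (mem_set BU), q), x.
have {gap} /choice[p pP] := gap.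
apply/card_le_injP; exists (fun z => ((p z).1, choice.pickle (p z).2)).
(* For a shared witness with rational [q] and point [x], [q < osc_op f (osc_at f z) x <= osc_at f w
   x < q]. *)
have pne z w : ord_below z w -> p z <> p w.
  move=> zw e; have [x [zx _ qx]] := pP z; have [_ [_ wq _]] := pP w.
  have := osc_at_mono f zw x; apply/negP; rewrite -ltNge.
  by apply: lt_trans qx; rewrite e; apply: wq; rewrite -e.
move=> z w [e1 /(pcan_inj (@choice.pickleK _)) e2].
have e : p z = p w by exact: injective_projections.
by have [/pne|//|/pne] := ord_below_trich z w; rewrite e.
Qed.

(** * Functions dominating the oscillations *)

Section complex_modulus.
Context {R : realType}.
Implicit Types (z w : R[i]) (r : R).
Local Notation normc := Normc.normc.

Lemma normcE z : `|z| = (normc z)%:C.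
Proof. by []. Qed.

Lemma normc_ge0 z : 0 <= normc z.
Proof. by rewrite -lecR -normcE normr_ge0. Qed.

Lemma normc_triangle z w : normc (z + w) <= normc z + normc w.
Proof. by rewrite -lecR rmorphD /= -!normcE ler_normD. Qed.

Lemma normc_distC z w : normc (z - w) = normc (w - z).
Proof. by apply: complexI; rewrite -!normcE distrC. Qed.

Lemma normc_real r : normc r%:C = `|r|.
Proof. by rewrite /Normc.normc /= expr0n addr0 sqrtr_sqr. Qed.

Lemma normc_Re z : `|complex.Re z| <= normc z.
Proof.
case: z => a b /=; rewrite -(sqrtr_sqr a) ler_sqrt ?lerDl ?sqr_ge0 //.
by rewrite addr_ge0 ?sqr_ge0.
Qed.

Lemma normc_Im z : `|complex.Im z| <= normc z.
Proof.
case: z => a b /=; rewrite -(sqrtr_sqr b) ler_sqrt ?lerDr ?sqr_ge0 //.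
by rewrite addr_ge0 ?sqr_ge0.
Qed.

Lemma normc_i : normc ('i : R[i]) = 1.
Proof. by rewrite -complexiE /= expr0n add0r expr1n sqrtr1. Qed.

(** The norm of [R[i]^o] takes values in [R[i]]; this passes to real tolerances, since a positive
    element of [R[i]] is real. *)
Lemma cvg_normcP (T : Type) (F : set_system T) (FF : Filter F)
    (u : T -> R[i]^o) (l : R[i]^o) :
  u @ F --> l <-> forall e : R, 0 < e ->
    \forall t \near F, normc (u t - l) < e.
Proof.
split=> [/cvgr_distC_lt ul e e0|ul].
  have := ul e%:C; rewrite ltcR => /(_ e0); apply: filterS => t.
  by rewrite normcE ltcR.
apply/cvgrPdistC_lt => e e0; have er : e = (complex.Re e)%:C.
  by apply/esym/RRe_real; exact: gtr0_real.
move: e0; rewrite er ltcR => e0; apply: filterS (ul _ e0) => t.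
by rewrite normcE ltcR.
Qed.

Lemma continuous_normcP (T : topologicalType) (u : T -> R[i]) :
  continuous (u : T -> R[i]^o) <-> forall x (e : R), 0 < e ->
    \forall y \near x, normc (u y - u x) < e.
Proof. by split=> h x; apply/cvg_normcP; exact: h. Qed.

Lemma continuous_realP (T : topologicalType) (u : T -> R) :
  continuous u <-> forall x (e : R), 0 < e ->
    \forall y \near x, `|u y - u x| < e.
Proof.
split=> [uc x e e0|uc x]; first by move/cvgr_distC_lt: (uc x) => /(_ e e0).
by apply/cvgrPdistC_lt => e e0; exact: uc.
Qed.

Lemma continuous_realC (T : topologicalType) (u : T -> R) :
  continuous u -> continuous ((fun x => (u x)%:C) : T -> R[i]^o).
Proof.
move=> /continuous_realP uc; apply/continuous_normcP => x e e0.
by apply: filterS (uc x e e0) => y; rewrite -normc_real rmorphB.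
Qed.

End complex_modulus.

Section dominating.
Context {R : realType} {K : topologicalType}.
Implicit Types (f : K -> R[i]) (h u : K -> R).
Local Notation normc := Normc.normc.

Definition lsc u := forall x (e : R), 0 < e -> \forall y \near x, u x - e < u y.

Lemma lscP u : lower_semicontinuous (EFin \o u) <-> lsc u.
Proof.
split=> [ul x e e0|ul x a].
  have [|V xV Vu] := ul x (u x - e); first by rewrite /= lte_fin ltrBlDr ltrDl.
  by apply: filterS xV => y /Vu; rewrite /= lte_fin.
rewrite /= lte_fin => ax; exists [set y | a < u y]; last first.
  by move=> y /=; rewrite lte_fin.
have := ul x (u x - a); rewrite subr_gt0 => /(_ ax).
by rewrite opprB addrC subrK.
Qed.

Lemma lscD u1 u2 : lsc u1 -> lsc u2 -> lsc (fun x => u1 x + u2 x).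
Proof.
move=> u1l u2l x e e0; have e2 : 0 < e / 2 by rewrite divr_gt0.
by apply: filterS2 (u1l x _ e2) (u2l x _ e2) => y; lra.
Qed.

Lemma lsc_half u : lsc u -> lsc (fun x => u x / 2).
Proof. by move=> ul x e e0; apply: filterS (ul x e e0) => y; lra. Qed.

Lemma continuous_lsc u : continuous u -> lsc u.
Proof.
move=> /continuous_realP uc x e e0; apply: filterS (uc x e e0) => y.
by rewrite ltr_norml; lra.
Qed.

(** An epsilon form of [limsup_(y -> x) (|f y - f x| + h y) <= h x]. *)
Definition dominates f h := forall x (e : R), 0 < e ->
  \forall y \near x, normc (f y - f x) + h y < h x + e.

Lemma dominates_osc_le f h a : (forall x, 0 <= h x) -> dominates f h ->
  forall x, (osc f a x <= (h x)%:E)%E.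
Proof.
move=> h0 fh; apply: (@osc_le _ _ _ (EFin \o h)) => [x|x].
  by rewrite /= lee_fin.
have next_le y : (osc_next f (EFin \o h) y <= (h y)%:E)%E.
  apply/lee_addgt0Pr => e e0; apply: limsup_le; apply: filterS (fh y e e0).
  by move=> z; rewrite /= -!EFinD lee_fin => /ltW.
(* The outer envelope costs nothing: [osc_next f h y <= h y <= |f y - f x| + h y], and the limsup of
   the last term is [osc_next f h x]. *)
apply: le_trans (next_le x); apply: limsup_mono => y.
apply: le_trans (next_le y) _ => /=.
by rewrite -[leLHS]add0e leeD2r // lee_fin normc_ge0.
Qed.

Lemma fixpoint_dominates f h (o : K -> \bar R) :
  (forall x, o x = (h x)%:E) -> osc_op f o = o -> dominates f h.
Proof.
move=> oh fix_o x e e0.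
have : (osc_next f o x < (h x + e)%:E)%E.
  apply: (@le_lt_trans _ _ (osc_op f o x)); first exact: limsup_ge.
  by rewrite fix_o oh lte_fin ltrDl.
move=> /limsup_lt; apply: filterS => y.
by rewrite oh -EFinD lte_fin.
Qed.

Lemma dominates_lsc f h u (c : R) :
  (forall x y, `|u y - u x| <= normc (f y - f x)) -> dominates f h ->
  lsc (fun x => c - h x + u x).
Proof.
move=> fu fh x e e0; apply: filterS (fh x e e0) => y.
have := fu x y; rewrite ler_norml => /andP[]; lra.
Qed.

(** If [t > - d] then [|t| <= t + 2 d]; so near [x] the sum of the [|u i y - u i x|] exceeds that of
    the signed differences by at most [4 * (e / 8)], and the values at [y] cancel. *)
Lemma lsc_dominates f (u : 'I_4 -> K -> R) (c : R) : (forall i, lsc (u i)) ->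
  (forall x y, normc (f y - f x) <= \sum_i `|u i y - u i x|) ->
  dominates f (fun x => c - \sum_i u i x).
Proof.
move=> ul fu x e e0; have e8 : 0 < e / 16 by rewrite divr_gt0.
have : \forall y \near x, forall i, u i x - e / 16 < u i y.
  by apply: filter_forall => i; exact: ul.
apply: filterS => y hy; have := fu x y.
have abs i : `|u i y - u i x| <= u i y - u i x + e / 8.
  by rewrite ler_norml; have := hy i; lra.
have : \sum_i `|u i y - u i x| <= \sum_i (u i y - u i x + e / 8).
  exact: ler_sum.
rewrite !big_split /= sumrN sumr_const card_ord -mulr_natr; lra.
Qed.

End dominating.

(** * Lower bounds from a representing series *)

Section representation.
Context {R : realType} {K : topologicalType}.
Implicit Types (f psi : K -> R[i]) (phi : nat -> K -> R[i]).
Local Notation normc := Normc.normc.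

Lemma continuous_partial_sum (F : numFieldType) (V : normedModType F)
    (u : nat -> K -> V) n : (forall j, continuous (u j)) ->
  continuous (fun x => \sum_(0 <= j < n) u j x).
Proof.
move=> uc; elim: n => [|n IH].
  rewrite (_ : (fun x => _) = cst 0); last by apply/funext => x; rewrite big_geq.
  by move=> x; exact: cvg_cst.
rewrite (_ : (fun x => _) = (fun x => \sum_(0 <= j < n) u j x + u n x)).
  by move=> x; apply: cvgD; [exact: IH | exact: uc].
by apply/funext => x; rewrite big_nat_recr.
Qed.

Lemma continuous_normc (u : K -> R[i]) : continuous (u : K -> R[i]^o) ->
  continuous (fun x => normc (u x)).
Proof.
move=> /continuous_normcP uc; apply/continuous_realP => x e e0.
apply: filterS (uc x e e0) => y uxy.
have := normc_triangle (u y - u x) (u x).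
have := normc_triangle (u x - u y) (u y).
rewrite !subrK (normc_distC (u x)) => h1 h2.
by rewrite ltr_norml; apply/andP; split; lra.
Qed.

(** With [s] the sum of the [|phi j|] and [M] its supremum, [M - s] dominates [f] and hence bounds
    the oscillation, while [|f - psi| <= s]. *)
Lemma represents_osc_le f psi phi a :
  continuous (psi : K -> R[i]^o) ->
  represents phi (fun x => f x - psi x) ->
  forall x, ((normc (f x - psi x))%:E + osc f a x <= abs_sum_sup phi)%E.
Proof.
move=> psic [phic phioo phif] x0.
pose Q n x := \sum_(0 <= j < n) normc (phi j x).
pose P n x := \sum_(0 <= j < n) phi j x.
pose S x := (\sum_(0 <= j <oo) (normc (phi j x))%:E)%E.
have QS n x : ((Q n x)%:E <= S x)%E.
  rewrite /Q -sumEFin; apply: nneseries_lim_ge => j _ _.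
  by rewrite lee_fin normc_ge0.
have SM x : (S x <= abs_sum_sup phi)%E by apply: ereal_sup_ubound; exists x.
have S0 x : (0 <= S x)%E by apply: nneseries_ge0 => j _ _; rewrite lee_fin normc_ge0.
have Sfin x : S x \is a fin_num.
  by rewrite ge0_fin_numE //; exact: le_lt_trans (SM x) phioo.
have Mfin : abs_sum_sup phi \is a fin_num.
  by rewrite ge0_fin_numE // (le_trans (S0 x0)).
pose s x := fine (S x); pose M := fine (abs_sum_sup phi).
have SE x : S x = (s x)%:E by rewrite /s fineK.
have ME : abs_sum_sup phi = M%:E by rewrite /M fineK.
have Qs n x : Q n x <= s x by rewrite -lee_fin -SE.
have sM x : s x <= M by rewrite -lee_fin -SE -ME.
have Qapprox x (e : R) : 0 < e -> exists n, s x - e < Q n x.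
  move=> e0; apply: contrapT => /forallNP nQ.
  have : (S x <= (s x - e)%:E)%E.
    apply: lime_le.
      by apply: is_cvg_nneseries => j _ _; rewrite lee_fin normc_ge0.
    apply: nearW => n; rewrite sumEFin lee_fin leNgt; apply/negP.
    exact: nQ.
  by rewrite SE lee_fin; lra.
have tail n x : normc (f x - psi x - P n x) <= s x - Q n x.
  apply/ler_addgt0Pr => e e0.
  have [N _ hN] := (cvg_normcP _ _ _).1 (phif x) e e0.
  have {hN} := hN (maxn n N) (leq_maxr _ _).
  rewrite seriesEnat /= -/(P _ x) => hN.
  have : normc (P (maxn n N) x - P n x) <= Q (maxn n N) x - Q n x.
    rewrite /P /Q (big_cat_nat (n := n)) ?leq_maxl //= addrAC subrr add0r.
    rewrite [in leRHS](big_cat_nat (n := n)) ?leq_maxl //= addrAC subrr add0r.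
    by rewrite -lecR rmorph_sum /= -normcE ler_norm_sum.
  have := Qs (maxn n N) x.
  have := normc_triangle (P (maxn n N) x - P n x) (f x - psi x - P (maxn n N) x).
  rewrite (normc_distC (f x - psi x)) [_ + (f x - _ - _)]addrC.
  rewrite addrA subrK; lra.
(* The tail bounds at [x] and [y] leave [2 (s x - Q n x) + (Q n x - Q n y)] plus the variations of
   [P n] and [psi]: five errors below [e / 5]. *)
have dom : dominates f (fun x => M - s x).
  move=> x e e0; have e5 : 0 < e / 5 by rewrite divr_gt0.
  have [n nQ] := Qapprox x _ e5.
  have Pnear := (continuous_normcP _).1 (continuous_partial_sum (n := n) phic) x _ e5.
  have psinear := (continuous_normcP _).1 psic x _ e5.
  have Qnear : \forall y \near x, Q n x - e / 5 < Q n y.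
    have Qc := @continuous_partial_sum _ R^o (fun j x => normc (phi j x)) n
      (fun j => continuous_normc (phic j)).
    apply: filterS ((continuous_realP _).1 Qc x _ e5) => y.
    by rewrite -/(Q n y) -/(Q n x) ltr_norml; lra.
  near=> y.
  have h1 : normc (P n y - P n x) < e / 5 by near: y.
  have h2 : normc (psi y - psi x) < e / 5 by near: y.
  have h3 : Q n x - e / 5 < Q n y by near: y.
  have := tail n x; have := tail n y.
  have -> : f y - f x = ((f y - psi y - P n y) - (f x - psi x - P n x)) +
     ((P n y - P n x) + (psi y - psi x)) by ring.
  have := normc_triangle ((f y - psi y - P n y) - (f x - psi x - P n x))
    ((P n y - P n x) + (psi y - psi x)).
  have := normc_triangle (P n y - P n x) (psi y - psi x).
  have := normc_triangle (f y - psi y - P n y) (- (f x - psi x - P n x)).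
  rewrite normcN; lra.
have h0 x : 0 <= M - s x by rewrite subr_ge0.
have oscle := dominates_osc_le a h0 dom x0.
rewrite ME; apply: le_trans (leeD2l _ oscle) _; rewrite -EFinD lee_fin.
have := tail 0%N x0; rewrite /P /Q !big_geq // !subr0; lra.
Unshelve. all: by end_near. Qed.

End representation.

(** * Semicontinuous functions on metric spaces *)

Section metric.
Context {R : realType} {K : metricType R}.
Implicit Types u v : K -> R.
Local Notation normc := Normc.normc.

(* Baire's Lipschitz approximations inf_y (u y + n d(x, y)) *)
Lemma lsc_nondecreasing_limit u : lsc u -> (forall x, 0 <= u x) ->
  exists U : nat -> K -> R, [/\ forall n, continuous (U n),
    forall x, U 0%N x = 0, forall n x, U n x <= U n.+1 x,
    forall n x, U n x <= u x &
    forall x (e : R), 0 < e -> exists n, u x - e < U n x].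
Proof.
move=> ul u0; pose S n x := [set u y + n%:R * mdist x y | y in [set: K]].
pose V n x := inf (S n x).
have V_le n x y : V n x <= u y + n%:R * mdist x y.
  apply: ge_inf; last by exists y.
  by exists 0 => _ [z _ <-]; rewrite addr_ge0 ?mulr_ge0 ?mdist_ge0.
have V_ge n x (c : R) : (forall y, c <= u y + n%:R * mdist x y) -> c <= V n x.
  by move=> h; apply: lb_le_inf; [exists (u x + n%:R * mdist x x), x | move=> _ [y _ <-]].
have V_lip n x y : V n x <= V n y + n%:R * mdist x y.
  rewrite -lerBlDr; apply: V_ge => z; rewrite lerBlDr.
  apply: le_trans (V_le n x z) _; rewrite -addrA lerD2l -mulrDr ler_wpM2l //.
  by rewrite addrC metric_triangle.
(* The sequence is shifted to start at zero, so that its increments telescope to [U n]. *)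
exists (fun n => if n is m.+1 then V m else cst 0); split.
- case=> [|n]; first by move=> x; exact: cvg_cst.
  apply/continuous_realP => x e e0.
  have n0 : 0 < n.+1%:R :> R by [].
  apply/nbhs_ballP; exists (e / n.+1%:R); first exact: divr_gt0.
  rewrite ballEmdist => y /=; rewrite ltr_pdivlMr // => xy.
  have := V_lip n x y; have := V_lip n y x; rewrite (metric_sym y x).
  have : n%:R * mdist x y <= mdist x y * n.+1%:R.
    by rewrite mulrC ler_wpM2l ?mdist_ge0 // ler_nat.
  by rewrite ltr_norml => h1 h2 h3; apply/andP; split; lra.
- by [].
- case=> [|n] x; first by apply: V_ge => y; rewrite mul0r addr0.
  apply: V_ge => y; apply: le_trans (V_le n x y) _.
  by rewrite lerD2l ler_wpM2r ?mdist_ge0 // ler_nat.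
- case=> [|n] x; first exact: u0.
  by apply: le_trans (V_le n x x) _; rewrite mdistxx mulr0 addr0.
- move=> x e e0; have e2 : 0 < e / 2 by rewrite divr_gt0.
  have /nbhs_ballP[d /= d0] := ul x _ e2; rewrite ballEmdist => ud.
  (* Within [d] of [x], lower semicontinuity bounds [u y]; farther away the penalty [n * d > u x]
     suffices, as [u y >= 0]. *)
  have [n nP] : exists n : nat, u x / d < n%:R.
    by exists (Num.truncn (u x / d)).+1; rewrite truncnS_gt.
  exists n.+1; apply: (@lt_le_trans _ _ (u x - e / 2)); first lra.
  apply: V_ge => y; have [/ud /= xy|dxy] := ltP (mdist x y) d.
    by apply: le_trans (ltW xy) _; rewrite lerDl mulr_ge0 ?mdist_ge0.
  have : n%:R * d <= n%:R * mdist x y by rewrite ler_wpM2l.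
  move: nP; rewrite ltr_pdivrMr //; have := u0 y; lra.
Qed.

(** The increments of [U - V] telescope to [u - v]; as [U] and [V] increase, their absolute values
    sum to at most [u + v]. *)
Lemma D_norm_le u v (C : R) : lsc u -> lsc v ->
  (forall x, 0 <= u x) -> (forall x, 0 <= v x) -> (forall x, u x + v x <= C) ->
  (D_norm (fun x => (u x - v x)%:C) <= C%:E)%E.
Proof.
move=> ul vl u0 v0 uvC.
have [U [Uc U0 Uincr Ule Ulim]] := lsc_nondecreasing_limit ul u0.
have [V [Vc V0 Vincr Vle Vlim]] := lsc_nondecreasing_limit vl v0.
have Umono x : {homo U^~ x : m n / (m <= n)%N >-> m <= n}.
  exact: (homo_leq (@lexx _ _) (@le_trans _ _) (fun n => Uincr n x)).
have Vmono x : {homo V^~ x : m n / (m <= n)%N >-> m <= n}.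
  exact: (homo_leq (@lexx _ _) (@le_trans _ _) (fun n => Vincr n x)).
pose w n x := U n x - V n x.
pose phi j x : R[i] := (w j.+1 x - w j x)%:C.
have phi_sum : (abs_sum_sup phi <= C%:E)%E.
  apply: ge_ereal_sup => _ [y _ <-]; apply: lime_le.
    by apply: is_cvg_nneseries => j _ _; rewrite lee_fin normc_ge0.
  apply: nearW => n; rewrite sumEFin lee_fin; apply: le_trans (uvC y).
  apply: (@le_trans _ _ (U n y + V n y)); last by rewrite lerD.
  have -> : U n y = \sum_(0 <= j < n) (U j.+1 y - U j y).
    by rewrite telescope_sumr // U0 subr0.
  have -> : V n y = \sum_(0 <= j < n) (V j.+1 y - V j y).
    by rewrite telescope_sumr // V0 subr0.
  rewrite -big_split /=; apply: ler_sum => j _.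
  rewrite -[leLHS]/(normc (w j.+1 y - w j y)%:C) normc_real ler_norml /w.
  have := Uincr j y; have := Vincr j y; lra.
have phi_rep : represents phi (fun x => (u x - v x)%:C).
  split.
  - move=> j; apply: continuous_realC => x; rewrite /w.
    by apply: cvgB; apply: cvgB; [exact: Uc|exact: Vc|exact: Uc|exact: Vc].
  - exact: le_lt_trans phi_sum (ltry _).
  - move=> x; apply/cvg_normcP => e e0; have e2 : 0 < e / 2 by rewrite divr_gt0.
    have [m hm] := Ulim x _ e2; have [n hn] := Vlim x _ e2.
    exists (maxn m n) => // N /=; rewrite geq_max => /andP[mN nN].
    have -> : series (fun j => phi j x) N = (w N x)%:C.
      rewrite seriesEnat /= /phi -(rmorph_sum (real_complex R)) telescope_sumr //.
      by rewrite /w U0 V0 !subr0.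
    rewrite -(rmorphB (real_complex R)) normc_real ltr_norml /w.
    have := Umono x _ _ mN; have := Vmono x _ _ nN.
    have := Ule N x; have := Vle N x; lra.
apply: le_trans phi_sum.
by apply: ereal_inf_lbound; exists phi.
Qed.

End metric.

Section insertion.
Context {R : realType} {K : metricType R}.
Implicit Types a b : K -> R.

Lemma lsc_closed_le b (c : R) : lsc b -> closed [set x | b x <= c].
Proof.
move=> bl; rewrite -openC (_ : ~` _ = [set x | c < b x]); last first.
  by apply/seteqP; split=> x /=; rewrite ltNge => /negP.
rewrite openE => x /= cx; have := bl x (b x - c); rewrite subr_gt0 => /(_ cx).
by rewrite opprB addrC subrK.
Qed.

(* An approximate form of the Katetov-Tong insertion theorem: add up Urysohn
   functions separating {b <= t_k} from {a >= t_(k+1)} along a subdivision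
   (t_k) of mesh e of an interval containing the ranges of a and b. *)
Lemma approx_insertion a b (M e : R) : 0 < e ->
  lsc (fun x => - a x) -> lsc b -> (forall x, a x <= b x) ->
  (forall x, `|a x| <= M) -> (forall x, `|b x| <= M) ->
  exists c : K -> R, continuous c /\
    forall x, a x - e <= c x /\ c x <= b x + e.
Proof.
move=> e0 al bl ab aM bM.
pose t (k : nat) : R := - M + k%:R * e.
have tS k : t k.+1 = t k + e by rewrite /t -natr1 mulrDl mul1r addrA.
have tmono : {homo t : m n / (m <= n)%N >-> m <= n}.
  by move=> m n mn; rewrite lerD2l ler_wpM2r ?ler_nat // ltW.
have /choice[q qP] : forall k, exists q : K -> R, [/\ continuous q,
    forall x, 0 <= q x <= 1, forall x, b x <= t k -> q x = 0 &
    forall x, t k.+1 <= a x -> q x = 1].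
  move=> k; pose B := [set x | b x <= t k]; pose A := [set x | - a x <= - t k.+1].
  have BA : B `&` A = set0.
    rewrite -subset0 => x [bx ax]; rewrite /A /B /= lerN2 tS in bx ax.
    by have := ab x; lra.
  have sepBA := (@normal_separatorP R K).1 pseudometric_normal B A
    (lsc_closed_le bl) (lsc_closed_le al) BA.
  have [q [qc q01 q0 q1]] := (@uniform_separatorP K R B A).1 sepBA.
  exists q; split=> // x.
  - by have := q01 (q x) (imageP _ I); rewrite /= in_itv.
  - by move=> bx; apply: q0; exists x.
  - by move=> ax; apply: q1; exists x => //; rewrite /A /= lerN2.
have [N NM] : exists N : nat, M < t N.
  exists (Num.truncn (2 * M / e)).+1.
  have := truncnS_gt (2 * M / e); rewrite ltr_pdivrMr // /t; lra.
pose c x := - M + e * \sum_(0 <= k < N) q k x.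
have q_le m n x : \sum_(m <= k < n) q k x <= (n - m)%:R.
  apply: (@le_trans _ _ (\sum_(m <= k < n) 1)); last by rewrite sumr_const_nat.
  by apply: ler_sum => k _; have [_ /(_ x) /andP[]] := qP k.
have q_ge0 m n x : 0 <= \sum_(m <= k < n) q k x.
  by apply: sumr_ge0 => k _; have [_ /(_ x) /andP[]] := qP k.
exists c; split.
  move=> x; apply: (@cvgD R R^o); first exact: cvg_cst.
  apply: cvgMr.
  have qc k : continuous (q k) by have [] := qP k.
  exact: (@continuous_partial_sum K R R^o q N qc x).
move=> x; have aMx := aM x; have bMx := bM x; rewrite !ler_norml in aMx bMx.
split.
  have /truncn_itv : 0 <= (a x + M) / e by rewrite divr_ge0 ?(ltW e0) //; lra.
  set m := Num.truncn _; rewrite ler_pdivlMr // ltr_pdivrMr // => /andP[ma am].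
  (* Here [t m <= a x < t m.+1]: the first [m] functions equal 1 at [x], so
     [c x >= t m > a x - e]. *)
  have mN : (m <= N)%N.
    rewrite leqNgt; apply/negP => /ltnW/tmono; move: ma NM; rewrite /t; lra.
  have qm : \sum_(0 <= k < m) q k x = m%:R.
    rewrite big_nat (eq_bigr (fun=> 1)); first by rewrite -big_nat sumr_const_nat subn0.
    move=> k /= km; have [_ _ _] := qP k; apply.
    by apply: (@le_trans _ _ (t m)); [exact: tmono | rewrite /t; lra].
  have q0 := q_ge0 m N x; rewrite /c (big_cat_nat (n := m)) //= qm.
  have := mulr_ge0 (ltW e0) q0; move: am; rewrite -natr1; lra.
have /truncn_itv : 0 <= (b x + M) / e by rewrite divr_ge0 ?(ltW e0) //; lra.
set m := Num.truncn _; rewrite ler_pdivlMr // ltr_pdivrMr // => /andP[mb bm].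
(* Here [t m <= b x < t m.+1]: only the [q k] with [k <= m] can be nonzero at [x], so
   [c x <= t m.+1 <= b x + e]. *)
have : \sum_(0 <= k < N) q k x <= m.+1%:R.
  have [Nm|mN] := leqP N m.+1.
    by apply: le_trans (q_le _ _ _) _; rewrite subn0 ler_nat.
  rewrite (big_cat_nat (n := m.+1)) ?(ltnW mN) //= [X in _ + X]big_nat.
  rewrite [X in _ + X]big1 => [|k /andP[mk _]].
    by rewrite addr0 -[X in _ <= X%:R]subn0 q_le.
  have [_ _ + _] := qP k; apply; apply: (@le_trans _ _ (t m.+1)).
    by rewrite /t; lra.
  exact: tmono.
move=> /(ler_wpM2l (ltW e0)); move: mb; rewrite /c -natr1; lra.
Qed.

End insertion.

(** * The D and quotient norms *)

Section D_characterization.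
Context {R : realType} {K : metricType R}.
Implicit Types (f : K -> R[i]) (g h : K -> R).
Local Notation normc := Normc.normc.

Lemma in_D_dominated f : in_D f -> exists h (M : R),
  (forall x, 0 <= h x <= M) /\ dominates f h.
Proof.
move=> [p1 [p2 [p3 [p4 [[[M1 b1] l1] [[M2 b2] l2] [[M3 b3] l3] [[M4 b4] l4] fE]]]]].
pose u (i : 'I_4) := nth p1 [:: p1; p2; p3; p4] i.
have uE x : \sum_i u i x = p1 x + p2 x + p3 x + p4 x.
  by rewrite !big_ord_recl big_ord0 /u /= addr0 !addrA.
exists (fun x => M1 + M2 + M3 + M4 - \sum_i u i x), (2 * (M1 + M2 + M3 + M4)).
split=> [x|].
  have := b1 x; have := b2 x; have := b3 x; have := b4 x.
  by rewrite uE !ler_norml; lra.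
apply: lsc_dominates => [i|x y].
  by case: i => -[|[|[|[|//]]]] i; exact/lscP.
rewrite !big_ord_recl big_ord0 /u /= addr0.
have -> : f y - f x = ((p1 y - p1 x) - (p2 y - p2 x))%:C +
    'i * ((p3 y - p3 x) - (p4 y - p4 x))%:C.
  by rewrite !fE !(rmorphB (real_complex R)); ring.
have := normc_triangle ((p1 y - p1 x) - (p2 y - p2 x))%:C
  ('i * ((p3 y - p3 x) - (p4 y - p4 x))%:C).
rewrite Normc.normcM normc_i mul1r !normc_real.
have := ler_normB (p1 y - p1 x) (p2 y - p2 x).
have := ler_normB (p3 y - p3 x) (p4 y - p4 x).
by rewrite /bump /=; lra.
Qed.

(** Each real coordinate [r] of [f] splits as [(- h + r) / 2 - (- h - r) / 2], a difference of lower
    semicontinuous functions. *)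
Lemma dominates_in_D f h (M M' : R) : (forall x, normc (f x) <= M) ->
  (forall x, 0 <= h x <= M') -> dominates f h -> in_D f.
Proof.
move=> fM hM fh.
have blsc (u : K -> R) : (forall x, `|u x| <= normc (f x)) ->
    (forall x y, `|u y - u x| <= normc (f y - f x)) ->
    bounded_lsc (fun x => (0 - h x + u x) / 2).
  move=> uM ul; split; last exact/lscP/lsc_half/(dominates_lsc _ ul fh).
  exists (M + M') => x; have := fM x; have := uM x; have /andP[] := hM x.
  by rewrite !ler_norml; lra.
exists (fun x => (0 - h x + complex.Re (f x)) / 2),
  (fun x => (0 - h x + - complex.Re (f x)) / 2),
  (fun x => (0 - h x + complex.Im (f x)) / 2),
  (fun x => (0 - h x + - complex.Im (f x)) / 2).
have ReB x y : complex.Re (f x) - complex.Re (f y) = complex.Re (f x - f y).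
  by case: (f x) (f y) => [? ?] [].
have ImB x y : complex.Im (f x) - complex.Im (f y) = complex.Im (f x - f y).
  by case: (f x) (f y) => [? ?] [].
split.
- by apply: blsc => [x|x y]; rewrite ?ReB normc_Re.
- by apply: blsc => [x|x y]; rewrite -?opprD ?ReB ?normrN normc_Re.
- by apply: blsc => [x|x y]; rewrite ?ImB normc_Im.
- by apply: blsc => [x|x y]; rewrite -?opprD ?ImB ?normrN normc_Im.
move=> x; rewrite [LHS]complexE complexiE; congr (_%:C + _ * _%:C); lra.
Qed.

Lemma D_norm_ge f a x : ((normc (f x))%:E + osc f a x <= D_norm f)%E.
Proof.
apply: le_ereal_inf_tmp => _ [phi phif <-].
have c0 : continuous ((fun=> 0) : K -> R[i]^o) by move=> y; exact: cvg_cst.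
have := represents_osc_le a c0 (phi := phi) (f := f); rewrite /= => h.
rewrite -[f x]subr0; apply: h.
by rewrite (_ : (fun x => f x - 0) = f) //; apply/funext => y; rewrite subr0.
Qed.

Lemma qD_norm_ge f a x : (osc f a x <= qD_norm f)%E.
Proof.
apply: le_ereal_inf_tmp => _ [psi [psic _] <-].
apply: le_ereal_inf_tmp => _ [phi phif <-].
apply: le_trans (represents_osc_le a psic phif x).
by rewrite leeDr // lee_fin normc_ge0.
Qed.

(** Insert a continuous [c] between [g + h - L - e] and [g - h + L + e]. Then [g - c = u - v] with
    [u, v >= 0] lower semicontinuous and [u + v = L + e - h <= L + e]. *)
Lemma qD_norm_le f g h (M L : R) : (forall x, f x = (g x)%:C) ->
  (forall x, `|g x| <= M) -> (forall x, 0 <= h x <= L) -> dominates f h ->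
  (qD_norm f <= L%:E)%E.
Proof.
move=> fg gM hL fh; apply/lee_addgt0Pr => e e0.
have gf x y : `|g y - g x| <= normc (f y - f x).
  by rewrite !fg -(rmorphB (real_complex R)) normc_real.
have Ngf x y : `|- g y - - g x| <= normc (f y - f x) by rewrite -opprD normrN.
have al : lsc (fun x => - (g x + h x - L)).
  have := dominates_lsc L Ngf fh; congr lsc; apply/funext => x; ring.
have bl : lsc (fun x => L - h x + g x) := dominates_lsc L gf fh.
have [|||c [cc ac]] := approx_insertion (M := M + L) e0 al bl.
- by move=> x; have := hL x; lra.
- by move=> x; have := hL x; have := gM x; rewrite !ler_norml; lra.
- by move=> x; have := hL x; have := gM x; rewrite !ler_norml; lra.
pose u x := (L + e - h x + g x - c x) / 2.
pose v x := (L + e - h x - g x + c x) / 2.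
have Ncc : continuous (fun x => - c x) by move=> x; apply: cvgN; exact: cc.
apply: (@le_trans _ _ (D_norm (fun x => (u x - v x)%:C))).
  apply: ereal_inf_lbound; exists (fun x => (c x)%:C).
    split; first exact: continuous_realC.
    exists (M + 2 * L + e) => x; rewrite normc_real.
    have := ac x; have := hL x; have := gM x; rewrite !ler_norml; lra.
  congr D_norm; apply/funext => x.
  rewrite fg -(rmorphB (real_complex R)); congr (_%:C); rewrite /u /v; lra.
rewrite -EFinD; apply: D_norm_le.
- by apply/lsc_half/lscD/continuous_lsc => //; exact: dominates_lsc gf fh.
- by apply/lsc_half/lscD/continuous_lsc => //; exact: dominates_lsc Ngf fh.
- by move=> x; rewrite /u; have := ac x; have := hL x; lra.
- by move=> x; rewrite /v; have := ac x; have := hL x; lra.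
- by move=> x; rewrite /u /v; have := hL x; lra.
Qed.

Lemma sup_norm_ge (r : K -> \bar R) x : (`|r x| <= sup_norm r)%E.
Proof. by apply: ereal_sup_ubound; exists x. Qed.

Lemma sup_norm_le (r : K -> \bar R) (c : \bar R) :
  (forall x, 0 <= r x)%E -> (forall x, r x <= c)%E -> (sup_norm r <= c)%E.
Proof. by move=> r0 rc; apply: ge_ereal_sup => _ [x _ <-]; rewrite gee0_abs. Qed.

(** The point [x0] rules out an empty supremum, which would be [-oo]. *)
Lemma sup_norm_fin (r : K -> \bar R) (x0 : K) (c : R) :
  (forall x, 0 <= r x)%E -> (forall x, r x <= c%:E)%E ->
  sup_norm r \is a fin_num.
Proof.
move=> r0 rc; rewrite ge0_fin_numE.
  exact: le_lt_trans (sup_norm_le r0 rc) (ltry _).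
exact: le_trans (abse_ge0 _) (sup_norm_ge _ x0).
Qed.

End D_characterization.

Theorem theorem3p2 (R : realType) (K : metricType R) (f : K -> R[i])
    (K_infinite : infinite_set [set: K])
    (f_bounded : exists M : R, forall x, Normc.normc (f x) <= M) :
  let mu := succ_card (weight K) in
  let stable := fun a : Ord =>
    ord_lt a mu /\ forall b : Ord, ord_lt a b -> osc f a = osc f b in
  (exists a : Ord, stable a) /\
  let tau := ord_least stable in
  (in_D f <-> exists M : R, forall x, (osc f tau x <= M%:E)%E) /\
  (forall g : K -> R, (forall x, f x = (g x)%:C) -> in_D f ->
    let N := sup_norm (fun x => ((Normc.normc (f x))%:E + osc f tau x)%E) in
    [/\ D_norm f = N,
        qD_norm f = sup_norm (osc f tau) &
        let lambda := fine N in
        let u := fun x => (lambda - fine (osc f tau x) + g x) / 2 in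
        let v := fun x => (lambda - fine (osc f tau x) - g x) / 2 in
        [/\ forall x, 0 <= u x /\ 0 <= v x,
            lower_semicontinuous (EFin \o u),
            lower_semicontinuous (EFin \o v),
            forall x, f x = (u x - v x)%:C &
            D_norm f = sup_norm (fun x => (u x + v x)%:E)]]).
Proof.
move=> mu stable.
have [a [amu fixa]] := osc_fixpoint_exists f K_infinite.
have stable_a : stable a by split=> //; exact: osc_stable.
have stable_ex : exists a, stable a by exists a.
split=> // tau.
have [[_ stable_tau] tau_le] : is_least stable tau := ord_leastP stable_ex.
(* Stability of [tau] constrains later ordinals only; since [tau] is below or isomorphic to [a], it
   inherits the fixed-point equation from [a]. *)
have tau_a : osc f tau = osc f a.
  by have [/stable_tau|/(osc_iso f)] := tau_le a stable_a.
have fix_tau : osc_op f (osc f tau) = osc f tau by rewrite tau_a.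
have [Mf fM] := f_bounded.
(* [fine] sends infinite values to 0, so [h] represents the oscillation only once a bound is
   known. *)
pose h x := fine (osc f tau x).
have h_bounded M : (forall x, (osc f tau x <= M%:E)%E) ->
    [/\ forall x, osc f tau x = (h x)%:E, forall x, 0 <= h x <= M &
        dominates f h].
  move=> oM; have oE x : osc f tau x = (h x)%:E.
    rewrite fineK // ge0_fin_numE ?osc_ge0 //.
    exact: le_lt_trans (oM x) (ltry _).
  split=> // [x|]; last exact: fixpoint_dominates oE fix_tau.
  by rewrite -!lee_fin -oE osc_ge0 oM.
have in_D_bounded : in_D f -> exists M : R, forall x, (osc f tau x <= M%:E)%E.
  move=> /in_D_dominated[k [M [kM fk]]]; exists M => x.
  have k0 y : 0 <= k y by have /andP[] := kM y.
  apply: le_trans (dominates_osc_le tau k0 fk x) _.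
  by rewrite lee_fin; have /andP[] := kM x.
split.
  split=> // -[M /h_bounded[_ hM fh]]; exact: dominates_in_D fM hM fh.
move=> g fg /in_D_bounded[M /h_bounded[oE hM fh]] N.
have [x0 _] := infinite_setN0 K_infinite.
have normf x : Normc.normc (f x) = `|g x| by rewrite fg normc_real.
have N_ge0 x : (0 <= (Normc.normc (f x))%:E + osc f tau x)%E.
  by rewrite adde_ge0 ?osc_ge0 // lee_fin normc_ge0.
have N_fin : N \is a fin_num.
  apply: (sup_norm_fin (c := Mf + M) x0) => // x.
  by rewrite oE -EFinD lee_fin lerD //; have /andP[] := hM x.
have o_fin : sup_norm (osc f tau) \is a fin_num.
  apply: (sup_norm_fin (c := M) x0) => [x|x]; first exact: osc_ge0.
  by rewrite oE lee_fin; have /andP[] := hM x.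
have gh_le x : `|g x| + h x <= fine N.
  rewrite -normf -lee_fin EFinD -oE fineK //.
  by apply: le_trans (sup_norm_ge _ x); rewrite gee0_abs.
have gf x y : `|g y - g x| <= Normc.normc (f y - f x).
  by rewrite !fg -(rmorphB (real_complex R)) normc_real.
have Ngf x y : `|- g y - - g x| <= Normc.normc (f y - f x).
  by rewrite -opprD normrN.
pose u x := (fine N - h x + g x) / 2.
pose v x := (fine N - h x - g x) / 2.
have ul : lsc u by exact/lsc_half/dominates_lsc/fh.
have vl : lsc v by exact/lsc_half/dominates_lsc/fh.
have u0 x : 0 <= u x.
  by have := gh_le x; have := ler_norm (- g x); rewrite normrN /u; lra.
have v0 x : 0 <= v x by have := gh_le x; have := ler_norm (g x); rewrite /v; lra.
have fuv x : f x = (u x - v x)%:C by rewrite fg /u /v; congr (_%:C); lra.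
have D_le c : (forall x, u x + v x <= c) -> (D_norm f <= c%:E)%E.
  move=> uvc; have -> : D_norm f = D_norm (fun x => (u x - v x)%:C).
    by congr D_norm; exact/funext.
  exact: (D_norm_le ul vl u0 v0 uvc).
have uv_le x : u x + v x <= fine N.
  by rewrite /u /v; have /andP[] := hM x; lra.
have DN : D_norm f = N.
  apply/eqP; rewrite eq_le; apply/andP; split.
    by have := D_le _ uv_le; rewrite fineK.
  by apply: sup_norm_le => // x; exact: D_norm_ge.
split=> //.
  apply/eqP; rewrite eq_le; apply/andP; split; last first.
    by apply: sup_norm_le => x; [exact: osc_ge0 | exact: qD_norm_ge].
  rewrite -[leRHS]fineK //; apply: (@qD_norm_le _ _ f g h Mf) => // x.
    by rewrite -normf.
  have /andP[-> _] := hM x; rewrite -lee_fin -oE fineK //.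
  by apply: le_trans (sup_norm_ge _ x); rewrite gee0_abs ?osc_ge0.
split; [by move=> x; split; [exact: u0 | exact: v0] | exact/lscP | exact/lscP | exact: fuv |].
rewrite -[RHS]/(sup_norm (fun x => (u x + v x)%:E)).
have uv0 x : (0 <= (u x + v x)%:E)%E by rewrite lee_fin addr_ge0.
have uvN x : ((u x + v x)%:E <= (fine N)%:E)%E by rewrite lee_fin.
(* One inequality is [D_le] with the supremum of [u + v] as constant; the other holds because
   [u + v = fine N - h <= fine N]. *)
apply/eqP; rewrite eq_le; apply/andP; split.
  have uv_fin := sup_norm_fin x0 uv0 uvN.
  rewrite -[leRHS]fineK //; apply: D_le => x.
  rewrite -lee_fin fineK //; apply: le_trans (sup_norm_ge _ x).
  by rewrite gee0_abs.
by have := sup_norm_le uv0 uvN; rewrite DN fineK.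
Qed.
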